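(* For every countably infinite bounded metric space $K$ there is a bounded metric space $Y$ of cardinality $2^{\aleph_0}$ such that for every partition of $Y$ into countably many pieces $Y=\bigcup_{n<\omega}Y_n$, some piece $Y_n$ contains a subspace which is a scaled copy of $K$. (In the paper's notation: $2^{\omega}\rightarrow_{\mathcal M}(\omega)^1_{\omega}$.)
   Context: A metric space $(A,d_A)$ is a scaled copy of a metric space $(B,d_B)$ if there are a bijection $f:A\to B$ and a constant $c\in\mathbb R^+$ such that $d_A(x,y)=c\cdot d_B(f(x),f(y))$ for all $x,y\in A$. $\mathcal M$ denotes the class of bounded metric spaces, with ''$X$ contains a copy of $K$'' meaning ''$X$ has a subspace which is a scaled copy of $K$''; $\kappa\rightarrow_{\mathcal M}(\lambda)^1_\mu$ means that for every $K\in\mathcal M$ of size $\lambda$ there is $Y\in\mathcal M$ of size $\kappa$ such that for any partition of $Y$ into $\mu$ pieces, one of the pieces contains a copy of $K$. *)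

(* Defs.v *)
From HB Require Import structures.
From mathcomp Require Import all_boot all_order all_algebra.
From mathcomp Require Import boolp classical_sets functions cardinality reals.
From mathcomp Require Import topology.
Set Implicit Arguments.
Unset Strict Implicit.
Unset Printing Implicit Defensive.
Import Order.TTheory GRing.Theory Num.Theory.
Local Open Scope classical_set_scope.
Local Open Scope ring_scope.

(* The library makes a subset of a pseudometric space a pseudometric space; the
   distance of the ambient space makes it a metric space. *)
Section MetricSubspace.
Context (R : realType) (X : metricType R) (A : set X).
Implicit Types x y : set_type A.

Let sdist x y : R := mdist (val x) (val y).

Let sdist_ge0 x y : 0 <= sdist x y.
Proof. exact: mdist_ge0. Qed.

Let sdist_positivity x y : sdist x y = 0 -> x = y.
Proof. by move=> /mdist_positivity/val_inj. Qed.

Let ballEsdist x (d : R) : ball x d = [set y | sdist x y < d].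
Proof.
by have := congr1 (preimage (@set_val _ A)) (ballEmdist (val x) d).
Qed.

HB.instance Definition _ := PseudoMetric_isMetric.Build R (set_type A)
  sdist_ge0 sdist_positivity ballEsdist.

Lemma mdist_set_typeE x y : mdist x y = mdist (val x) (val y).
Proof. by []. Qed.

End MetricSubspace.

Definition bounded_metric (R : realType) (X : metricType R) : Prop :=
  exists M : R, forall x y : X, mdist x y <= M.

Definition scaled_copy (R : realType) (A B : metricType R) : Prop :=
  exists f : A -> B, exists c : R,
    [/\ bijective f, 0 < c & forall x y : A, mdist x y = c * mdist (f x) (f y)].

Definition contains_copy (R : realType) (X : metricType R) (S : set X)
    (K : metricType R) : Prop :=
  exists A : set X, A `<=` S /\ scaled_copy (set_type A : metricType R) K.

(* Unlike in the library's [partition], pieces may be empty, so that partitions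
   into finitely many pieces are included. *)
Definition countable_partition (T : Type) (P : nat -> set T) : Prop :=
  \bigcup_n P n = [set: T] /\ trivIset [set: nat] P.

(* Main.v *)
(** A point that realizes a Katetov function [f] over a countable set is a
    promise that keeps it at distance [f a] from each [a]. Suppose that [Y]
    realizes every Katetov function with values at most 1 on a countable subset,
    and that no piece contains a scaled copy of [K]. Treat the pieces in turn. In
    piece [n], among the points keeping all earlier promises, build a copy of [K],
    scaled small enough to be compatible with these promises, one point after the
    other. The construction gets stuck at a finite stage, so finitely many further
    promises rule out piece [n]. Along all [n] these are countably many promises,
    realized by a point of [Y] that lies in no piece.

    Such a [Y] of cardinality continuum consists of well-founded trees with
    countable branching: a node carries a Katetov function on the points given by
    its subtrees, and the distance is the shortest-path distance, cut at 1. A tree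
    is coded by a subset of a countable set, which bounds the cardinality. *)
From HB Require Import structures.
Require Import Defs.
From mathcomp Require Import all_boot all_order all_algebra.
From mathcomp Require Import boolp classical_sets functions cardinality reals.
From mathcomp Require Import topology.
From mathcomp Require Import lra.
Set Implicit Arguments.
Unset Strict Implicit.
Unset Printing Implicit Defensive.
Import Order.TTheory GRing.Theory Num.Theory.
Local Open Scope classical_set_scope.
Local Open Scope card_scope.

(** * Katetov trees and their truncated path distance *)

Section KatetovTrees.
Local Open Scope ring_scope.
Context (R : realType).

(** A partial function is given by its graph [S]; when [d x x = 0], the middle inequality makes [S]
    single-valued. *)
Definition katetov (X : Type) (d : X -> X -> R) (S : set (X * R)) :=
  forall p q, S p -> S q ->
    [/\ d p.1 q.1 <= p.2 + q.2, p.2 <= q.2 + d p.1 q.1 & p.2 <= 1].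

(* Distinct leaves will be at distance 1: their labels make the space as large as
   the continuum. *)
Inductive ktree : Type :=
| Leaf of (nat -> bool)
| Node of (nat -> ktree) & (nat -> R).

Definition edges (x : ktree) : set (ktree * R) :=
  if x is Node a f then range (fun i => (a i, f i)) else set0.

(** Each step descends in only one of the two trees, hence the nested fixpoints; the element 1 is
    the cut. *)
Fixpoint kdist (x : ktree) : ktree -> R := fix kdistx (y : ktree) : R :=
  if `[< x = y >] then 0 else
  inf ([set 1] `|`
       (if x is Node a f then range (fun i => f i + kdist (a i) y) else set0) `|`
       (if y is Node b g then range (fun j => g j + kdistx (b j)) else set0)).

Definition kcand (x y : ktree) : set R :=
  [set 1] `|` [set p.2 + kdist p.1 y | p in edges x]
          `|` [set q.2 + kdist x q.1 | q in edges y].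

Lemma kdistE x y : kdist x y = if `[< x = y >] then 0 else inf (kcand x y).
Proof.
have -> : kcand x y = [set 1] `|`
       (if x is Node a f then range (fun i => f i + kdist (a i) y) else set0) `|`
       (if y is Node b g then range (fun j => g j + kdist x (b j)) else set0).
  rewrite /kcand; congr (_ `|` _ `|` _).
  - by case: x => [b|a f] /=; rewrite ?image_set0 ?image_comp.
  - by case: y => [b|a f] /=; rewrite ?image_set0 ?image_comp.
by case: x => [b|a f]; case: y.
Qed.

Lemma kdistxx x : kdist x x = 0.
Proof. by rewrite kdistE asboolT. Qed.

Lemma le_kdist x y r : x <> y -> lbound (kcand x y) r -> r <= kdist x y.
Proof.
move=> xy lb; rewrite kdistE asboolF//; apply: lb_le_inf => //.
by exists 1; left; left.
Qed.

(** Raw labels are arbitrary; validity imposes the Katetov inequalities at every node and provides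
    induction along edges. *)
Inductive kvalid (x : ktree) : Prop :=
  KValid of (forall p, edges x p -> kvalid p.1) & katetov kdist (edges x).

Lemma kvalid_edge x p : kvalid x -> edges x p -> kvalid p.1.
Proof. by case=> xv _; exact: xv. Qed.

Lemma kvalid_kat x : kvalid x -> katetov kdist (edges x).
Proof. by case. Qed.

Lemma edge_ge0 x p : kvalid x -> edges x p -> 0 <= p.2.
Proof.
move=> /kvalid_kat xk xp; have [+ _ _] := xk _ _ xp xp.
by rewrite kdistxx; lra.
Qed.

Lemma kdist_ge0 x y : kvalid x -> kvalid y -> 0 <= kdist x y.
Proof.
move=> xv; elim: xv y => {}x xe IHx xk y yv; elim: yv => {}y ye IHy yk.
have [->|xy] := pselect (x = y); first by rewrite kdistxx.
have xv : kvalid x by split.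
have yv : kvalid y by split.
apply: le_kdist => // _ [[->//|[p xp <-]]|[q yq <-]].
- by rewrite addr_ge0 ?(edge_ge0 xv xp)// IHx.
- by rewrite addr_ge0 ?(edge_ge0 yv yq)// IHy.
Qed.

Lemma kdist_le x y r : kvalid x -> kvalid y -> kcand x y r -> kdist x y <= r.
Proof.
move=> xv yv cr.
have lb0 : lbound (kcand x y) 0.
  move=> _ [[->//|[p xp <-]]|[q yq <-]].
  - exact: addr_ge0 (edge_ge0 xv xp) (kdist_ge0 (kvalid_edge xv xp) yv).
  - exact: addr_ge0 (edge_ge0 yv yq) (kdist_ge0 xv (kvalid_edge yv yq)).
rewrite kdistE; case: asboolP => _; first exact: lb0.
by apply: ge_inf => //; exists 0.
Qed.

Lemma kdist_le1 x y : kvalid x -> kvalid y -> kdist x y <= 1.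
Proof. by move=> xv yv; apply: kdist_le => //; left; left. Qed.

Lemma kdist_lel x y p : kvalid x -> kvalid y -> edges x p ->
  kdist x y <= p.2 + kdist p.1 y.
Proof. by move=> xv yv xp; apply: kdist_le => //; left; right; exists p. Qed.

Lemma kdist_ler x y q : kvalid x -> kvalid y -> edges y q ->
  kdist x y <= q.2 + kdist x q.1.
Proof. by move=> xv yv yq; apply: kdist_le => //; right; exists q. Qed.

Lemma kdist_sym x y : kvalid x -> kvalid y -> kdist x y = kdist y x.
Proof.
move=> xv; elim: xv y => {}x xe IHx xk y yv; elim: yv => {}y ye IHy yk.
rewrite !kdistE; have -> : `[< x = y >] = `[< y = x >].
  by apply/asboolP/asboolP.
congr (if _ then _ else inf _); rewrite /kcand setUAC.
congr (_ `|` _ `|` _); apply: eq_imagel => p pe.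
- by rewrite IHy.
- by rewrite IHx//; split.
Qed.

(* A shortest path never needs a peak [p.1 - y - q.1]: the Katetov inequality
   at [y] lets it be replaced by a path between [p.1] and [q.1]. *)
Lemma kdist_triangle y x z : kvalid x -> kvalid y -> kvalid z ->
  kdist x z <= kdist x y + kdist y z.
Proof.
move=> xv yv zv.
(* Induction on [y] is outermost, with [x] and [z] free: at a peak the hypothesis for [q.1] is used
   with [p.1] as third point. *)
elim: yv x z xv zv => {}y ye IHy yk x z xv.
have yv : kvalid y by split.
elim: (xv) z => {xv}x xe IHx xk z zv.
have xv : kvalid x by split.
elim: (zv) => {zv}z ze IHz zk.
have zv : kvalid z by split.
have [->|xy] := pselect (x = y); first by rewrite kdistxx add0r.
have [->|yz] := pselect (y = z); first by rewrite kdistxx addr0.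
rewrite -lerBlDr; apply: le_kdist => // _ [[->|[p xp <-]]|[q yq <-]].
- by have := kdist_ge0 yv zv; have := kdist_le1 xv zv; lra.
- by have := IHx _ xp _ zv; have := kdist_lel xv zv xp; lra.
have qv := ye _ yq.
rewrite lerBlDr -lerBlDl; apply: le_kdist => // _ [[->|[p yp <-]]|[p zp <-]].
- have := kdist_ge0 xv qv; have := kdist_le1 xv zv; have := edge_ge0 yv yq.
  by lra.
- have pv := ye _ yp; have [+ _ _] := yk _ _ yq yp.
  have := IHy _ yq _ _ xv pv; have := IHy _ yp _ _ xv zv; lra.
- have := IHz _ zp; have := kdist_ler xv zv zp.
  by have := kdist_ler xv yv yq; lra.
Qed.

(** * Subtrees and exactness of edge lengths *)

Inductive kdesc (x : ktree) : ktree -> Prop :=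
| KDesc0 : kdesc x x
| KDescS y p of edges y p & kdesc x p.1 : kdesc x y.

Lemma kdesc_trans y x z : kdesc x y -> kdesc y z -> kdesc x z.
Proof.
by move=> xy; elim=> // {}z p zp _ ?; exact: KDescS zp _.
Qed.

(** A cycle through a tree would pass through a child and give a cycle there, which structural
    induction excludes. *)
Lemma kdesc_acyclic x p : edges x p -> ~ kdesc x p.1.
Proof.
elim: x p => [b|a IHa f] p //= [i _ <-] /= xai.
have ia : edges (Node a f) (a i, f i) by exists i.
case Ei: _ / (xai) => [|y q yq xq]; last first.
  rewrite -Ei in yq; apply: (IHa i q yq); apply: kdesc_trans xq.
  exact: KDescS ia (KDesc0 _).
have := IHa i (a i, f i); move: ia; rewrite -Ei => ia /(_ ia); apply.
exact: KDesc0.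
Qed.

Lemma kdist_edge x p : kvalid x -> edges x p -> kdist x p.1 = p.2.
Proof.
move=> xv xp; have xk := kvalid_kat xv.
apply/eqP; rewrite eq_le; apply/andP; split.
  have := kdist_lel xv (kvalid_edge xv xp) xp; rewrite kdistxx; lra.
(* Generalized from [p.1] to every [z] without [x] as a subtree: this condition passes down the
   edges of [z], so induction on [z] applies, and steps along edges of [x] fall to the Katetov
   inequalities at [x]. *)
suff H z : kvalid z -> ~ kdesc x z ->
    forall q, edges x q -> q.2 <= kdist x z + kdist z q.1.
  have := H _ (kvalid_edge xv xp) (kdesc_acyclic xp) _ xp.
  by rewrite kdistxx addr0.
move=> zv; elim: (zv) => {zv}z ze IHz zk nxz q xq.
have zv : kvalid z by split.
have qv := kvalid_edge xv xq.
have xz : x <> z by move=> xz; apply: nxz; rewrite xz; exact: KDesc0.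
rewrite -lerBlDr; apply: le_kdist => // _ [[->|[r xr <-]]|[r zr <-]].
- by have [_ _ +] := xk _ _ xq xq; have := kdist_ge0 zv qv; lra.
- have rv := kvalid_edge xv xr.
  have [_ + _] := xk _ _ xq xr; have := kdist_triangle rv zv qv.
  by rewrite (kdist_sym qv rv); lra.
- have nxr : ~ kdesc x r.1 by move=> xr; apply: nxz; exact: KDescS zr xr.
  have := IHz _ zr nxr _ xq; have := kdist_lel zv qv zr.
  have rv := ze _ zr; have := kdist_triangle rv zv qv.
  have := kdist_lel zv rv zr; rewrite kdistxx (kdist_sym zv rv); lra.
Qed.

(** * The metric space of valid trees up to distance 0 *)

HB.instance Definition _ := gen_eqMixin ktree.
HB.instance Definition _ := gen_choiceMixin ktree.

(** Distinct valid trees may be at distance 0; a chosen representative of each class replaces the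
    quotient. *)
Definition krep (x : ktree) : ktree :=
  xget (Leaf xpred0) [set y | kvalid y /\ kdist x y = 0].

Lemma krepP x : kvalid x -> kvalid (krep x) /\ kdist x (krep x) = 0.
Proof. move=> xv; apply: (@xgetPex _ _ [set y | kvalid y /\ kdist x y = 0]).
by exists x; split=> //; exact: kdistxx. Qed.

Lemma kdist0_eq x y z : kvalid x -> kvalid y -> kvalid z -> kdist x y = 0 ->
  kdist x z = kdist y z.
Proof.
move=> xv yv zv xy0.
have := kdist_triangle xv yv zv; have := kdist_triangle yv xv zv.
by rewrite (kdist_sym yv xv) xy0; lra.
Qed.

Lemma krep_eq x y : kvalid x -> kvalid y -> kdist x y = 0 -> krep x = krep y.
Proof.
move=> xv yv xy0; congr xget; apply/seteqP; split=> z /= [zv].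
  by rewrite -(kdist0_eq xv yv zv).
by rewrite (kdist0_eq xv yv zv).
Qed.

Record kspace := KSpace {
  kpoint :> ktree;
  kspaceP : `[< kvalid kpoint /\ krep kpoint = kpoint >] }.

HB.instance Definition _ := [isSub for kpoint].
HB.instance Definition _ := [Choice of kspace by <:].

Lemma kpoint_valid (x : kspace) : kvalid x.
Proof. by case: x => x /= /asboolP[]. Qed.

Lemma kspace_mdistxx (x : kspace) : kdist x x = 0.
Proof. exact: kdistxx. Qed.

Lemma kspace_positivity (x y : kspace) : kdist x y = 0 -> x = y.
Proof.
case: x y => [x /[dup] /asboolP[xv xE] xP] [y /[dup] /asboolP[yv yE] yP] /= xy0.
by apply: val_inj; rewrite /= -xE -yE; exact: krep_eq.
Qed.

Lemma kspace_sym (x y : kspace) : kdist x y = kdist y x.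
Proof. exact: kdist_sym (kpoint_valid x) (kpoint_valid y). Qed.

Lemma kspace_triangle (y x z : kspace) : kdist x z <= kdist x y + kdist y z.
Proof.
exact: kdist_triangle (kpoint_valid x) (kpoint_valid y) (kpoint_valid z).
Qed.

HB.instance Definition _ := isMetric.Build R kspace
  kspace_mdistxx kspace_positivity kspace_sym kspace_triangle.

Lemma kspace_mdistE (x y : kspace) : mdist x y = kdist x y.
Proof. by []. Qed.

Lemma kspace_of x : kvalid x -> exists y : kspace, kdist x y = 0.
Proof.
move=> xv; have [rv r0] := krepP xv.
have rP : `[< kvalid (krep x) /\ krep (krep x) = krep x >].
  by apply/asboolP; split=> //; rewrite -(krep_eq xv rv r0).
by exists (KSpace rP).
Qed.

Lemma kspace_le1 (x y : kspace) : mdist x y <= 1.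
Proof. exact: kdist_le1 (kpoint_valid x) (kpoint_valid y). Qed.

(** * Realizing Katetov functions on countable sets *)

Lemma countable_range (T : choiceType) (S : set T) (p0 : T) :
  countable S -> S p0 -> exists e : nat -> T, S = range e.
Proof.
move=> /countable_injP[f finj] Sp0.
exists (fun n => xget p0 [set p | S p /\ f p = n]).
apply/seteqP; split=> [p Sp|_ [n _ <-]]; last by case: xgetP => [y _ []|].
exists (f p) => //; apply: xget_unique => // q [Sq fqp].
by apply: finj; rewrite ?inE.
Qed.

(** The node with edge set [S] is valid and has the right distances by [kdist_edge]; these survive
    passing to its representative. *)
Lemma kspace_extension (S : set (kspace * R)) : countable S -> S !=set0 ->
  katetov mdist S ->
  exists y : kspace, forall p, S p -> mdist y p.1 = p.2.
Proof.
move=> Sc [p0 Sp0] Sk.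
have [e SE] := countable_range Sc Sp0.
pose x := Node (fun i => kpoint (e i).1) (fun i => (e i).2).
have xv : kvalid x.
  split=> [_ [i _ <-]|_ _ [i _ <-] [j _ <-]] /=; first exact: kpoint_valid.
  by apply: (Sk (e i) (e j)); rewrite SE; [exists i|exists j].
have [y xy0] := kspace_of xv.
exists y => p; rewrite SE => -[i _ <-].
rewrite kspace_mdistE -(kdist0_eq xv (kpoint_valid _) (kpoint_valid _) xy0).
by apply: (@kdist_edge x (_, _)) => //; exists i.
Qed.

(** * Cardinality of the tree space *)

Lemma kvalid_Leaf b : kvalid (Leaf b).
Proof. by split. Qed.

Lemma kdist_Leaf b c : b <> c -> kdist (Leaf b) (Leaf c) = 1.
Proof.
move=> bc; apply/le_anti/andP; split.
  exact: kdist_le1 (kvalid_Leaf b) (kvalid_Leaf c).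
by apply: le_kdist => [[]|_ [[->//|[p []]]|[q []]]].
Qed.

Lemma cantor_le_kspace : [set: nat -> bool] #<= [set: kspace].
Proof.
have /choice[h hP] b := kspace_of (kvalid_Leaf b).
have hinj : injective h.
  move=> b c hbc; apply: contrapT => /kdist_Leaf.
  have vb := kvalid_Leaf b; have vc := kvalid_Leaf c.
  rewrite (kdist0_eq vb (kpoint_valid (h b)) vc (hP b)) hbc.
  rewrite (kdist_sym (kpoint_valid _) vc) hP => /esym/eqP.
  by rewrite oner_eq0.
rewrite -(card_le_eql (inj_card_eq (in2W hinj))); exact: subset_card_le.
Qed.

(** The Dedekind cut of [r], with which a set of rationals codes a real. *)
Definition ratcut (r : R) (q : rat) : bool := ratr q < r.

Lemma ratcut_inj : injective ratcut.
Proof.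
move=> r s rs; apply/eqP; rewrite eq_le !leNgt; apply/andP; split; apply/negP.
- move=> /rat_in_itvoo[q]; rewrite in_itv/= => /andP[sq qr].
  have := congr1 (@^~ q) rs.
  by rewrite /ratcut qr => /esym; rewrite ltNge (ltW sq).
- move=> /rat_in_itvoo[q]; rewrite in_itv/= => /andP[sq qr].
  by have := congr1 (@^~ q) rs; rewrite /ratcut qr ltNge (ltW sq).
Qed.

(** Answers to queries at address [s]: [None] asks for a leaf, [inl n] for bit [n] of a leaf,
    [inr (i, r)] for the cut of the [i]-th label of a node. *)
Fixpoint kcode (x : ktree) (s : seq nat)
    (q : option (nat + nat * rat)) : bool :=
  match x, s, q with
  | Leaf _, _, None => true
  | Leaf b, _, Some (inl n) => b n
  | Node _ f, [::], Some (inr (i, r)) => ratcut (f i) r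
  | Node a _, i :: s', _ => kcode (a i) s' q
  | _, _, _ => false
  end.

Lemma kcode_inj x y : kcode x =2 kcode y -> x = y.
Proof.
elim: x y => [b|a IHa f] [c|a' g] xy.
- by congr Leaf; apply/funext => n; exact: (xy [::] (Some (inl n))).
- by have := xy [::] None.
- by have := xy [::] None.
- congr Node; apply/funext => i.
    by apply: IHa => s q; exact: (xy (i :: s) q).
  apply: ratcut_inj; apply/funext => r.
  exact: (xy [::] (Some (inr (i, r)))).
Qed.

Lemma kspace_le_cantor : [set: kspace] #<= [set: nat -> bool].
Proof.
apply/pcard_injP.
exists (fun x n =>
  if unpickle n is Some (s, q) then kcode (kpoint x) s q else false).
move=> x y _ _ xy; apply: val_inj; apply: kcode_inj => s q.
by have := congr1 (@^~ (pickle (s, q))) xy; rewrite pickleK.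
Qed.

Lemma kspace_card : [set: kspace] #= [set: nat -> bool].
Proof.
apply/card_eqPle.
by split; [exact: kspace_le_cantor|exact: cantor_le_kspace].
Qed.

End KatetovTrees.

(** * Promises and scaled copies *)

Section Arrow.
Local Open Scope ring_scope.
Context (R : realType) (K Y : metricType R).

Definition realizes (S : set (Y * R)) (y : Y) :=
  forall p, S p -> mdist y p.1 = p.2.

(** The positive lower bound [e] leaves room for a copy of [K] of diameter at most [e]. *)
Definition promise (S : set (Y * R)) :=
  [/\ countable S, S !=set0, katetov mdist S &
      exists2 e, 0 < e & forall p, S p -> e <= p.2].

Lemma finite_pos_lbound (h : nat -> R) n :
  (forall i, (i < n)%N -> 0 < h i) ->
  exists2 e, 0 < e & forall i, (i < n)%N -> e <= h i.
Proof.
elim: n => [|n IHn] h0; first by exists 1.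
have [i /ltnW/h0//|e e0 he] := IHn.
exists (Num.min e (h n)); first by rewrite lt_min e0 h0.
move=> i; rewrite ltnS leq_eqVlt => /predU1P[->|/he ehi].
  by rewrite ge_min lexx orbT.
by rewrite ge_min ehi.
Qed.

(** As [k] is injective and [c] positive, [g] is injective, so a point of its range determines an
    index. *)
Lemma contains_copy_seq (P : set Y) (k : nat -> K) (g : nat -> Y) (c : R) :
  bijective k -> 0 < c -> (forall i, P (g i)) ->
  (forall i j, mdist (g i) (g j) = c * mdist (k i) (k j)) ->
  contains_copy P K.
Proof.
move=> [k' kK k'K] c0 Pg gk.
have gI : injective g.
  move=> i j gij; apply: (can_inj kK); apply: mdist_positivity.
  by have /esym/eqP := gk i j; rewrite gij mdistxx mulf_eq0 gt_eqF//= => /eqP.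
exists (range g); split=> [_ [i _ <-]//|].
have /choice[h hP] (x : set_type (range g)) : exists i, g i = val x.
  by case: x => x /= /set_mem[i _ <-]; exists i.
have gr i : g i \in range g by apply/mem_set; exists i.
exists (k \o h), c; split=> // [|x y]; last by rewrite mdist_set_typeE -!hP gk.
exists (fun x => exist _ (g (k' x)) (gr (k' x)) : set_type (range g)) => x /=.
  by apply: val_inj; rewrite /= kK hP.
by rewrite -[RHS]k'K; congr k; apply: gI; rewrite hP.
Qed.

(* If no point of [P] ever realizes the promise to extend a partial copy inside
   [P] to the next point of [K], that promise rules out [P] for good; the copy is
   scaled down to the distances already promised in [S], which makes the new
   promise compatible with [S]. *)
Lemma copy_or_promise (P : set Y) (k : nat -> K) (S : set (Y * R)) :
  bijective k -> bounded_metric K -> promise S ->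
  contains_copy P K \/
  exists S', [/\ S `<=` S', promise S' & forall y, P y -> ~ realizes S' y].
Proof.
move=> kbij [M KM] [Sc [p0 Sp0] Sk [e e0 Se]].
have [|noS] := pselect (exists S', [/\ S `<=` S', promise S' &
  forall y, P y -> ~ realizes S' y]); [by right|left].
(* This makes every scaled distance at most [e]; the absolute value and the 1 keep the denominator
   positive. *)
pose c := e / (`|M| + 1).
have M0 : 0 < `|M| + 1 by rewrite ltr_wpDl.
have c0 : 0 < c by rewrite divr_gt0.
have ce (x y : K) : c * mdist x y <= e.
  rewrite /c mulrAC ler_pdivrMr// ler_pM2l//.
  by have := KM x y; have := ler_norm M; lra.
have e1 : e <= 1 by have [_ _ +] := Sk _ _ Sp0 Sp0; have := Se _ Sp0; lra.
have k_gt0 i j : (i < j)%N -> 0 < mdist (k j) (k i).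
  move=> ij; rewrite mdist_gt0; apply/eqP => /(bij_inj kbij) ji.
  by rewrite ji ltnn in ij.
pose next (l : seq Y) := S `|`
  [set (nth p0.1 l i, c * mdist (k (size l)) (k i)) | i in `I_(size l)].
pose good (l : seq Y) := [/\
  forall i, (i < size l)%N -> P (nth p0.1 l i),
  forall i, (i < size l)%N -> realizes S (nth p0.1 l i) &
  forall i j, (i < size l)%N -> (j < size l)%N ->
    mdist (nth p0.1 l i) (nth p0.1 l j) = c * mdist (k i) (k j)].
(* If a good list had no next point in [P], [next l] would be a promise ruling out [P], against
   [noS]. *)
have /choice[F FP] l : exists y, good l -> P y /\ realizes (next l) y.
  have [lgood|] := pselect (good l); last by exists p0.1.
  have [lP lS ld] := lgood.
  apply: contrapT => nex; apply: noS; exists (next l); split.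
  - by move=> p Sp; left.
  - split.
    + rewrite /next -bigcup2E; apply: bigcup_countable => // -[|[|n]] _ //=.
      apply: finite_set_countable.
      exact/finite_image/finite_II.
    + by exists p0; left.
    + have cD0 (x y : K) : 0 <= c * mdist x y.
        by rewrite mulr_ge0 ?mdist_ge0// ltW.
      (* Points of the partial copy realize [S], so mixed distances are the promised ones, and the
         mixed inequalities follow from scaled distances lying between 0 and [e]. *)
      move=> p q [Sp|[i il <-]] [Sq|[j jl <-]] /=.
      * exact: Sk.
      * have [_ _ p1] := Sk _ _ Sp Sp; rewrite metric_sym (lS j jl p Sp).
        by have := cD0 (k (size l)) (k j); split; lra.
      * rewrite (lS i il q Sq); have := Se _ Sq.
        have := cD0 (k (size l)) (k i); have := ce (k (size l)) (k i).
        by split; lra.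
      * rewrite ld//; have := ce (k (size l)) (k i).
        have tri (x y z : K) : c * mdist x z <= c * mdist x y + c * mdist y z.
          by rewrite -mulrDr ler_pM2l// metric_triangle.
        have := tri (k i) (k (size l)) (k j).
        rewrite (metric_sym (k i) (k (size l))).
        have := tri (k (size l)) (k j) (k i); rewrite (metric_sym (k j) (k i)).
        by split; lra.
    + have [i il|e' e'0 he'] :=
        @finite_pos_lbound (fun i => c * mdist (k (size l)) (k i)) (size l).
        by rewrite mulr_gt0// k_gt0.
      exists (Num.min e e'); first by rewrite lt_min e0.
      move=> p [Sp|[i il <-]]; rewrite ge_min; first by rewrite Se.
      by rewrite /= (he' i il) orbT.
  - move=> y Py yr; apply: nex; exists y => _; split => //.
pose L n := iter n (fun l => rcons l (F l)) [::].
pose g n := F (L n).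
have LE n : L n = mkseq g n.
  by elim: n => // n IH; rewrite /L iterS -/(L n) IH mkseqS -IH.
have Lgood n : good (L n).
  elim: n => [|n [IHP IHS IHd]]; first by split.
  have [Pg gr] := FP _ (And3 IHP IHS IHd).
  rewrite /L iterS -/(L n).
  split=> [i|i|i j]; rewrite size_rcons !ltnS !nth_rcons.
  - by case: ltngtP => // /IHP.
  - by case: ltngtP => // [/IHS //|_ _] p Sp; apply: gr; left.
  - have gd m : (m < size (L n))%N ->
        mdist (F (L n)) (nth p0.1 (L n) m) = c * mdist (k (size (L n))) (k m).
      by move=> mn; apply: (gr (_, _)); right; exists m.
    case: ltngtP => // [il|->] _; case: ltngtP => // [jl|->] _.
    + exact: IHd.
    + by rewrite metric_sym gd// (metric_sym (k i)).
    + exact: gd.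
    + by rewrite !mdistxx mulr0.
have size_L n : size (L n) = n by rewrite LE size_mkseq.
apply: (@contains_copy_seq P k g c) => // [i|i j].
- by have [] := FP _ (Lgood i).
- have [_ _] := Lgood (maxn i j).+1; rewrite size_L => /(_ i j).
  rewrite !ltnS leq_maxl leq_maxr LE.
  by rewrite !nth_mkseq ?ltnS ?leq_maxl ?leq_maxr//; exact.
Qed.

(** * Diagonalization over countably many pieces *)

Lemma katetov_bigcup (S : nat -> set (Y * R)) :
  (forall n, S n `<=` S n.+1) -> (forall n, katetov mdist (S n)) ->
  katetov mdist (\bigcup_n S n).
Proof.
move=> Sinc Sk p q [m _ Smp] [n _ Snq].
have Smono : {homo S : i j / (i <= j)%N >-> i `<=` j}.
  by apply: homo_leq => // [A|B A C]; [exact: subset_refl|exact: subset_trans].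
apply: (Sk (maxn m n)).
- exact: Smono (leq_maxl m n) _ Smp.
- exact: Smono (leq_maxr m n) _ Snq.
Qed.

Lemma saturated_arrow (k : nat -> K) (y0 : Y) (P : nat -> set Y) :
  bijective k -> bounded_metric K ->
  (forall S : set (Y * R), countable S -> S !=set0 -> katetov mdist S ->
    exists y, realizes S y) ->
  \bigcup_n P n = [set: Y] -> exists n, contains_copy (P n) K.
Proof.
move=> kbij Kbd ext Pcover; apply: contrapT => nocopy.
have /choice[N NP] (nS : nat * set (Y * R)) : exists S', promise nS.2 ->
    [/\ nS.2 `<=` S', promise S' & forall y, P nS.1 y -> ~ realizes S' y].
  have [Sp|nS2] := pselect (promise nS.2); last by exists set0.
  have [copy|[S' S'P]] := copy_or_promise (P nS.1) kbij Kbd Sp; last first.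
    by exists S'.
  by case: nocopy; exists nS.1.
pose S := fix S n := if n is m.+1 then N (m, S m) else [set (y0, 1)].
have Sp n : promise (S n).
  elim: n => [|n IHn] /=; last by have [] := NP (n, S n) IHn.
  split; [exact: countable1|by exists (y0, 1)|move=> _ _ -> -> /=|].
    by rewrite mdistxx; split; lra.
  by exists 1 => // _ ->.
have Sinc n : S n `<=` S n.+1 by have [] := NP (n, S n) (Sp n).
have [y yS] : exists y, realizes (\bigcup_n S n) y.
  apply: ext; first by apply: bigcup_countable => // n _; have [] := Sp n.
    by exists (y0, 1), 0.
  by apply: katetov_bigcup => // n; have [] := Sp n.
have [n _ Pny] : (\bigcup_n P n) y by rewrite Pcover.
(* [S n.+1] was chosen to rule out [P n], yet [y] lies in [P n] and realizes it. *)
have [_ _ /(_ _ Pny)] := NP (n, S n) (Sp n); apply => p Sn1p.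
by apply: yS; exists n.+1.
Qed.

End Arrow.

Unset Implicit Arguments.

Theorem theorem1p2 (R : realType) (K : metricType R)
    (K_infty : [set: K] #= [set: nat]) (K_bounded : bounded_metric K) :
  exists Y : metricType R,
    [/\ bounded_metric Y,
        [set: Y] #= [set: nat -> bool] &
        forall P : nat -> set Y, countable_partition P ->
          exists n : nat, contains_copy (P n) K].
Proof.
have [k kbij] : exists k : nat -> K, bijective k.
  have /card_set_bijP[k'] := K_infty.
  by rewrite setTT_bijective => -[k kK k'K]; exists k, k'.
exists (kspace R); split; first by exists 1%R; exact: kspace_le1.
  exact: kspace_card.
move=> P [Pcover _]; have [y0 _] := kspace_of (kvalid_Leaf R xpred0).
by apply: (saturated_arrow y0 kbij K_bounded _ Pcover); exact: kspace_extension.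
Qed.
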